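(* Let $A=\mathrm{IDD}(K^0_\infty,1,0)$ be the complex algebra with basis $e_0,e_1,e_2,\ldots$ and bilinear multiplication $e_i\diamond e_j=i\,e_{i+j-1}$ (read as $0$ when $i=0$). Then the space of derivations of $A$ is $$\mathfrak{Der}(A)=\langle\varphi,\phi\rangle,\qquad \varphi(e_i)=(i-1)e_i,\quad \phi(e_i)=i\,e_{i-1}\quad(i\ge0),$$ with $\phi(e_0)=0$.
   Context: A derivation of an algebra $(A,\diamond)$ is a linear map $D:A\to A$ with $D(a\diamond b)=D(a)\diamond b+a\diamond D(b)$ for all $a,b\in A$. $\langle S\rangle$ denotes the linear span of $S$ over $\mathbb C$. *)

(* Defs.v *)
From HB Require Import structures.
From mathcomp Require Import all_boot all_order all_algebra.
From mathcomp Require Import all_classical all_reals.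
From mathcomp Require Export complex.

Set Implicit Arguments.
Unset Strict Implicit.
Unset Printing Implicit Defensive.
Import Order.TTheory GRing.Theory Num.Theory.
Local Open Scope ring_scope.
Local Open Scope classical_set_scope.

Section LinearAlgebra.
Variables (K : nzRingType) (V : lmodType K).

Definition linear_span (S : set V) : set V :=
  [set v | exists (n : nat) (c : 'I_n -> K) (u : 'I_n -> V),
     (forall k, S (u k)) /\ v = \sum_(k < n) c k *: u k].

Definition Der (mul : V -> V -> V) : set (V -> V) :=
  [set D | linear D /\ forall a b, D (mul a b) = mul (D a) b + mul a (D b)].

End LinearAlgebra.

(* {poly R[i]} serves only as the free complex vector space on a countable
   basis, realised by the monomials; its ring product plays no role. *)
Section IDD.
Variable R : realType.
Local Notation A := {poly R[i]}.

Definition e (k : nat) : A := 'X^k.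

(* The linear map sending e k to f k. *)
Definition linext (f : nat -> A) (a : A) : A := \sum_(k < size a) a`_k *: f k.

(* The product is the bilinear extension of the table on the e i; the truncated
   index at i = j = 0 is harmless, since the coefficient vanishes for i = 0. *)
Definition idd_mul (a b : A) : A :=
  linext (fun i => linext (fun j => i%:R *: e (i + j).-1) b) a.

Definition varphi : A -> A := linext (fun k => (k%:R - 1) *: e k).
Definition phi : A -> A := linext (fun k => k%:R *: e k.-1).

Lemma e_spanning (a : A) : a = \sum_(k < size a) a`_k *: e k.
Proof. by rewrite -poly_def coefK. Qed.

Lemma e_free n (c : nat -> R[i]) :
  \sum_(k < n) c k *: e k = 0 -> forall k, (k < n)%N -> c k = 0.
Proof.
rewrite -poly_def => c0 k lt_kn.
by have := congr1 (fun p : A => p`_k) c0; rewrite coef_poly lt_kn coef0.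
Qed.

Lemma linext_e f k : linext f (e k) = f k.
Proof.
rewrite /linext /e size_polyXn big_ord_recr /=.
rewrite coefXn eqxx scale1r big1 ?add0r // => i _.
by rewrite coefXn ltn_eqF ?scale0r.
Qed.

Lemma linext_linear f : linear (linext f).
Proof.
have E n (a : A) : (size a <= n)%N -> linext f a = \sum_(k < n) a`_k *: f k.
  move=> le_n; rewrite /linext (big_ord_widen _ (fun k => a`_k *: f k) le_n).
  rewrite big_mkcond /=; apply: eq_bigr => k _; case: ltnP => // hk.
  by rewrite nth_default ?scale0r.
move=> c a b; pose n := maxn (size (c *: a + b)) (maxn (size a) (size b)).
rewrite !(E n) ?leq_max ?leqnn ?orbT //.
rewrite scaler_sumr -big_split /=; apply: eq_bigr => k _.
by rewrite coefD coefZ scalerDl scalerA.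
Qed.

Lemma idd_mul_e i j : idd_mul (e i) (e j) = i%:R *: e (i + j).-1.
Proof. by rewrite /idd_mul !linext_e. Qed.

Lemma varphi_e k : varphi (e k) = (k%:R - 1) *: e k.
Proof. exact: linext_e. Qed.

Lemma phi_e k : phi (e k) = k%:R *: e k.-1.
Proof. exact: linext_e. Qed.

End IDD.

(* Main.v *)
Require Import Defs.
From HB Require Import structures.
From mathcomp Require Import all_boot all_order all_algebra.
From mathcomp Require Import all_classical all_reals.
From mathcomp Require Import ring.

Import GRing.Theory Num.Theory.
Local Open Scope ring_scope.
Local Open Scope classical_set_scope.

(** Identify [e k] with the monomial ['X^k].  The table
    [e i * e j = i e (i + j - 1)] then says that the product of [a] and [b] is
    [a^`() * b], while [phi a = a^`()] and [varphi a = 'X * a^`() - a]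
    ([idd_mulE], [phiE], [varphiE]).  That these two maps are derivations is a
    direct computation with the Leibniz rule.

    Conversely, let [D (a^`() * b) = (D a)^`() * b + a^`() * D b].  Taking
    [a = 1], then [a = 'X], with [b = 1] shows that [D 1] and [D 'X] have zero
    derivative, so they are constants [c] and [d].  Taking [a = 'X^2] with
    [b = 1] determines [(D 'X^2)^`()]; feeding that back with [b] arbitrary
    gives, after division by 2, the recursion
    [D ('X * b) = (d - c 'X) * b + 'X * D b] ([der_mulX]).  This recursion and
    [D 1 = c] determine [D], and [d phi - c varphi] satisfies them too. *)

Section Derivations.
Variable R : realType.
Local Notation C := R[i].
Local Notation A := {poly C}.

(** A linear map is the linear extension of its values on the basis; this
    turns the sums defining the product, [phi] and [varphi] into closed
    formulas. *)
Lemma linextE (L : A -> A) (f : nat -> A) (a : A) :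
  linear L -> (forall k, L 'X^k = f k) -> linext f a = L a.
Proof.
move=> linL Lf.
pose LL : {linear A -> A} :=
  HB.pack L (GRing.isLinear.Build C A A *:%R L linL).
rewrite -[RHS]/(LL a) [in RHS](e_spanning a) linear_sum /linext.
by apply: eq_bigr => k _; rewrite linearZ /= /e Lf.
Qed.

Lemma idd_mulE (a b : A) : idd_mul a b = a^`() * b.
Proof.
apply: (@linextE (fun p => p^`() * b)) => [k p q|i].
  by rewrite linearP /= mulrDl scalerAl.
rewrite derivXn; apply/esym.
apply: (@linextE (fun p => 'X^(i.-1) *+ i * p)) => [k p q|j].
  by rewrite mulrDr scalerAr.
rewrite mulrnAl -exprD scaler_nat /e.
by case: i => [|i]; rewrite ?mulr0n.
Qed.

Lemma phiE (a : A) : phi a = a^`().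
Proof.
by apply: linextE => [|k]; [exact: linearP|rewrite derivXn scaler_nat].
Qed.

Lemma varphiE (a : A) : varphi a = 'X * a^`() - a.
Proof.
apply: (@linextE (fun p => 'X * p^`() - p)) => [k p q|k].
  by rewrite linearP /= mulrDr scalerBr -scalerAr opprD addrACA.
rewrite derivXn scalerBl scale1r scaler_nat /e.
by case: k => [|k]; rewrite ?mulr0n ?mulr0 // mulrnAr -exprS.
Qed.

(** The coefficient [p`_i.+1] appears in [p^`()] multiplied by [i.+1], which is
    nonzero in characteristic zero. *)
Lemma deriv_eq0_const (p : A) : p^`() = 0 -> p = (p`_0)%:P.
Proof.
move=> p'0; apply/polyP => -[|i]; rewrite coefC //=.
have /eqP := congr1 (fun q : A => q`_i) p'0.
by rewrite coef_deriv coef0 mulrn_eq0 => /eqP.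
Qed.

Lemma Der_phi : Der (@idd_mul R) (@phi R).
Proof.
split; first exact: linext_linear.
by move=> a b; rewrite !idd_mulE !phiE derivM.
Qed.

Lemma Der_varphi : Der (@idd_mul R) (@varphi R).
Proof.
split; first exact: linext_linear.
move=> a b; rewrite !idd_mulE !varphiE !(derivB, derivM, derivX); ring.
Qed.

(** The product being bilinear, derivations are stable under linear
    combinations. *)
Lemma Der_sum n (c : 'I_n -> C) (u : 'I_n -> A -> A) :
  (forall k, Der (@idd_mul R) (u k)) ->
  Der (@idd_mul R) (\sum_(k < n) c k *: u k).
Proof.
move=> uP.
have sumE a : (\sum_(k < n) c k *: u k) a = \sum_(k < n) c k *: u k a.
  by rewrite fct_sumE.
split=> [x a b|a b]; rewrite !sumE.
  rewrite scaler_sumr -big_split; apply: eq_bigr => k _ /=.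
  by rewrite (uP k).1 scalerDr !scalerA mulrC.
rewrite !idd_mulE linear_sum mulr_suml mulr_sumr -big_split.
apply: eq_bigr => k _ /=.
have := (uP k).2 a b; rewrite !idd_mulE derivZ => ->.
by rewrite scalerDr scalerAl scalerAr.
Qed.

Section Classification.
Variable D : A -> A.
Hypothesis DerD : Der (@idd_mul R) D.

Let linD : linear D := DerD.1.

Let DM (a b : A) : D (a^`() * b) = (D a)^`() * b + a^`() * D b.
Proof. by have := DerD.2 a b; rewrite !idd_mulE. Qed.

Let DD a b : D (a + b) = D a + D b.
Proof. by have := linD 1 a b; rewrite !scale1r. Qed.

Let D0 : D 0 = 0.
Proof. by apply: (addrI (D 0)); rewrite -DD !addr0. Qed.

Let DZ k a : D (k *: a) = k *: D a.
Proof. by have := linD k a 0; rewrite D0 !addr0. Qed.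

Lemma der_one : D 1 = ((D 1)`_0)%:P.
Proof.
apply: deriv_eq0_const; have := DM 1 1.
by rewrite derivC !mul0r D0 addr0 mulr1.
Qed.

Lemma der_X : D 'X = ((D 'X)`_0)%:P.
Proof.
apply: deriv_eq0_const; have := DM 'X 1.
rewrite derivX !mul1r mulr1 => D1; apply: (addIr (D 1)).
by rewrite -D1 add0r.
Qed.

(** Since ['X] is half the derivative of ['X^2], the derivation rule reaches
    multiplication by ['X], at the price of the unknown [(D 'X^2)^`()], which
    the case [b = 1] of the same rule eliminates. *)
Lemma der_mulX (b : A) : D ('X * b) = (D 'X - 'X * D 1) * b + 'X * D b.
Proof.
have two_neq0 : (2%:R : C) != 0 by rewrite pnatr_eq0.
have D2 (p : A) : 2%:R *: D ('X * p) = ((D 'X^2)^`()) * p + 2%:R *: ('X * D p).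
  have := DM 'X^2 p.
  by rewrite derivXn expr1 -scaler_nat -!scalerAl DZ.
have DX2 : (D 'X^2)^`() = 2%:R *: (D 'X - 'X * D 1).
  by have := D2 1; rewrite !mulr1 scalerBr => ->; rewrite addrK.
apply: (scalerI two_neq0).
by rewrite D2 DX2 -scalerAl -scalerDr.
Qed.

(** Horner induction: [der_mulX] propagates the formula from [p] to ['X * p],
    and the constant added at each step is handled by [D 1].  The coefficients
    are forced by [varphi 1 = -1], [varphi 'X = 0], [phi 1 = 0] and
    [phi 'X = 1]. *)
Lemma der_classification (a : A) :
  D a = - (D 1)`_0 *: varphi a + (D 'X)`_0 *: phi a.
Proof.
elim/poly_ind: a => [|p k IH].
  by rewrite D0 varphiE phiE deriv0 mulr0 subr0 !scaler0 addr0.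
rewrite DD mulrC der_mulX IH -[k%:P]mulr1 mul_polyC DZ.
rewrite !varphiE !phiE derivD derivM derivX derivZ derivC scaler0.
rewrite der_one der_X !coefC /= -!mul_polyC polyCN; ring.
Qed.

End Classification.
End Derivations.

Theorem corollary3p2 (R : realType) :
  Der (@idd_mul R) = linear_span [set @varphi R; @phi R].
Proof.
apply/seteqP; split=> [D DerD|_ [n [c [u [uP ->]]]]].
  exists 2%N, (fun k => if k == 0 then - (D 1)`_0 else (D 'X)`_0).
  exists (fun k => if k == 0 then @varphi R else @phi R); split.
    by move=> k; case: ifP => _; [left|right].
  by apply/funext => a; rewrite big_ord_recl big_ord1 /= der_classification.
apply: Der_sum => k.
by case: (uP k) => ->; [exact: Der_varphi|exact: Der_phi].
Qed.
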